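(* Let $K$ be a field of characteristic zero, $R=K[x_1,x_2,x_3]$, $s\ge 2$, and let $I=(L_0^2,L_1^{a_1},\dots,L_s^{a_s})$, where $L_0,\dots,L_s$ are general linear forms and $a_1,\dots,a_s$ are positive integers. Let $L$ be a general linear form. Then for all integers $d\ge1$ and $j$, the map $\times L^d:[R/I]_{j-d}\to[R/I]_j$ has maximal rank; that is, $R/I$ has the Strong Lefschetz Property.
   Context: A map has maximal rank if it is injective or surjective. ''General'' means in a suitable nonempty Zariski open set. *)

(* Defs.v *)
From HB Require Import structures.
From mathcomp Require Import all_boot all_order all_algebra.
From mathcomp Require Import mpoly.
Set Implicit Arguments. Unset Strict Implicit. Unset Printing Implicit Defensive.
Import GRing.Theory.
Local Open Scope ring_scope.

Definition linform (K : fieldType) (n : nat) (c : 'I_n -> K) : {mpoly K[n]} :=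
  \sum_(i < n) c i *: 'X_i.

Definition in_ideal (K : fieldType) (n m : nat) (g : 'I_m -> {mpoly K[n]})
  (f : {mpoly K[n]}) : Prop :=
  exists h : 'I_m -> {mpoly K[n]}, f = \sum_(k < m) h k * g k.

(* The K-linear map  x L^d : [R/I]_i -> [R/I]_(i+d)  (I = (g)), is injective. *)
Definition mult_inj (K : fieldType) (n m : nat) (g : 'I_m -> {mpoly K[n]})
  (L : {mpoly K[n]}) (d i : nat) : Prop :=
  forall f : {mpoly K[n]}, f \is i.-homog ->
    in_ideal g (L ^+ d * f) -> in_ideal g f.

Definition mult_surj (K : fieldType) (n m : nat) (g : 'I_m -> {mpoly K[n]})
  (L : {mpoly K[n]}) (d i : nat) : Prop :=
  forall h : {mpoly K[n]}, h \is (i + d)%N.-homog ->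
    exists2 f : {mpoly K[n]}, f \is i.-homog & in_ideal g (h - L ^+ d * f).

Definition mult_max_rank (K : fieldType) (n m : nat) (g : 'I_m -> {mpoly K[n]})
  (L : {mpoly K[n]}) (d i : nat) : Prop :=
  mult_inj g L d i \/ mult_surj g L d i.

(* Strong Lefschetz property of R/I with respect to L: for all d >= 1 and all
   degrees, x L^d : [R/I]_(j-d) -> [R/I]_j has maximal rank.  Degrees j < d
   (domain zero) are trivially injective, so we index by i = j - d >= 0. *)
Definition SLP_wrt (K : fieldType) (n m : nat) (g : 'I_m -> {mpoly K[n]})
  (L : {mpoly K[n]}) : Prop :=
  forall d i : nat, (0 < d)%N -> mult_max_rank g L d i.

Definition forms_of (K : fieldType) (s : nat) (v : 'I_(s.+1 * 3) -> K)
  (k : 'I_s.+1) : {mpoly K[3]} :=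
  linform (fun i : 'I_3 => v (mxvec_index k i)).

Definition exps (s : nat) (a : 'I_s -> nat) (k : 'I_s.+1) : nat :=
  if unlift ord0 k is Some k' then a k' else 2%N.

Definition gens (K : fieldType) (s : nat) (a : 'I_s -> nat)
  (v : 'I_(s.+1 * 3) -> K) (k : 'I_s.+1) : {mpoly K[3]} :=
  forms_of v k ^+ exps a k.

(* Main.v *)
(* Modulo L_0^2 a form of degree e is p + L_0 q with p, q binary, so each
   [R/L_0^2]_e has dimension 2e + 1.  It suffices that for general forms the map
     (+)_k [R/L_0^2]_(j - a_k) -> [R/L_0^2]_j,   (f_k) |-> sum_k L_k^(a_k) f_k,
   is injective or surjective, where L^d counts among the powers: injectivity
   makes x L^d injective on R/I, and surjectivity makes it surjective.  Maximal
   rank is an open condition, so one choice of forms is enough.  Take L_0 = z and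
   L_k = x + t_k y + c_k z.  A functional on [R/z^2]_j killing the image amounts
   to univariate polynomials A, B of degrees < j and <= j with
     (X - t_k)^(e_k) | A  and  (X - t_k)^(e_k + 1) | B + c_k A,   e_k = j - a_k;
   dividing out E = prod_k (X - t_k)^(e_k) leaves the interpolation conditions
   B_0(t_k) + c_k A_0(t_k) = 0.  With c_k = t_k^(N + 1), N = j - deg E, these say
   that B_0 + X^(N + 1) A_0, of degree <= 2N, vanishes at every t_k.  When there
   are fewer than 2N + 1 conditions, extra forms with exponent j make the
   map square, and its bijectivity gives injectivity of the original one. *)

Require Import Defs.
From HB Require Import structures.
From mathcomp Require Import all_boot all_order all_algebra.
From mathcomp Require Import mpoly.
From mathcomp Require Import zify ring.
Set Implicit Arguments. Unset Strict Implicit. Unset Printing Implicit Defensive.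
Import GRing.Theory.
Local Open Scope ring_scope.

(** * Univariate polynomials: divisibility and interpolation *)

Lemma natr_inj_pchar0 (K : fieldType) :
  [pchar K] =i pred0 -> injective (fun n : nat => n%:R : K).
Proof.
move=> charK m n /eqP; wlog le_mn : m n / (m <= n)%N.
  by case/orP: (leq_total m n) => le IH E; [|apply/esym]; apply: IH => //; rewrite eq_sym.
rewrite eq_sym -subr_eq0 -natrB // (proj1 (pcharf0P K)) // subn_eq0 => le_nm.
by apply/eqP; rewrite eqn_leq le_mn.
Qed.

Lemma poly_ext_pchar0 (K : fieldType) (p q : {poly K}) :
  [pchar K] =i pred0 -> (forall T, p.[T] = q.[T]) -> p = q.
Proof.
move=> charK eq_pq; apply/eqP; rewrite -subr_eq0; apply/negPn/negP => nz.
pose rs := [seq i%:R : K | i <- iota 0 (size (p - q))].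
have: (size rs < size (p - q)%R)%N.
  apply: max_poly_roots => //; last by rewrite map_inj_uniq ?iota_uniq //; exact: natr_inj_pchar0.
  by apply/allP => x _; rewrite rootE !hornerE eq_pq subrr.
by rewrite size_map size_iota ltnn.
Qed.

(** The expansion at t is assumed for values only, since the polynomials of interest are known
    through the values of a functional on powers of linear forms; characteristic zero makes it an
    identity of polynomials. *)
Lemma dvdp_exp_XsubC_taylor (K : fieldType) (p : {poly K}) (t : K) (m n : nat)
    (c : nat -> K) :
    [pchar K] =i pred0 -> (forall r, (r < m)%N -> c r = 0) ->
    (forall T, p.[T] = \sum_(r < n) c r * (T - t) ^+ r) ->
  ('X - t%:P) ^+ m %| p.
Proof.
move=> charK c0 Ep.
have -> : p = \sum_(r < n) c r *: ('X - t%:P) ^+ r.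
  apply: poly_ext_pchar0 => // T; rewrite Ep horner_sum.
  by apply: eq_bigr => r _; rewrite !hornerE.
apply: (big_ind (dvdp (('X - t%:P) ^+ m))) => [|x y dx dy|r _]; [exact: dvdp0 | exact: dvdp_add |].
have [lt_rm|le_mr] := ltnP r m; first by rewrite c0 // scale0r dvdp0.
by rewrite -mul_polyC; apply: dvdp_mull; exact: dvdp_exp2l.
Qed.

Lemma dvdp_prod_exp_XsubC (K : fieldType) (J : finType) (t : J -> K)
    (e : J -> nat) (p : {poly K}) :
    injective t -> (forall k, ('X - (t k)%:P) ^+ e k %| p) ->
  \prod_k ('X - (t k)%:P) ^+ e k %| p.
Proof.
move=> inj_t dvd_p; have := index_enum_uniq J.
elim: (index_enum J) => [|k r IH] /=; first by rewrite big_nil dvd1p.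
case/andP => k_r /IH dvd_r; rewrite big_cons Gauss_dvdp ?dvd_p //.
rewrite big_seq; apply: (big_ind (coprimep _)) => [|x y cx cy|l l_r]; first exact: coprimep1.
  by rewrite coprimepMr cx.
apply/coprimep_expl/coprimep_expr/coprimep_XsubC2; rewrite subr_eq0.
by apply: contraNneq k_r => /inj_t <-.
Qed.

(* With E the product of the ('X - t k) ^+ e k, write A = A0 E and B = B0 E:
   then B0 + 'X^(j - deg E).+1 * A0 vanishes at the t k with k in act, and the
   monomials of its two terms are distinct. *)
Lemma paired_interpolation (K : fieldType) (J : finType) (act : {set J})
    (t : J -> K) (e : J -> nat) (j : nat) (A B : {poly K}) :
    injective t -> (size A <= j)%N -> (size B <= j.+1)%N ->
    (forall k, ('X - (t k)%:P) ^+ e k %| A) ->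
    (forall k, ('X - (t k)%:P) ^+ e k %| B) ->
    (forall k, k \in act ->
      ('X - (t k)%:P) ^+ (e k).+1 %| B + t k ^+ (j - \sum_k e k).+1 *: A) ->
    (j < \sum_k e k)%N || ((j - \sum_k e k).*2 < #|act|)%N ->
  A = 0 /\ B = 0.
Proof.
move=> inj_t szA szB dvA dvB dvAB bnd.
set E := \prod_k ('X - (t k)%:P) ^+ e k.
have monE : E \is monic by apply: monic_prod => k _; rewrite monic_exp ?monicXsubC.
have szE : size E = (\sum_k e k).+1.
  rewrite size_prod => [|k _]; last by rewrite expf_neq0 // polyXsubC_eq0.
  under eq_bigr do rewrite size_exp_XsubC.
  have -> : (\sum_(k : J) (e k).+1 = \sum_(k : J) e k + #|J|)%N.
    by rewrite -sum1_card -big_split /=; apply: eq_bigr => k _; rewrite addn1.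
  by rewrite -addSn addnK.
have /dvdpP [A0 EA] : E %| A by exact: dvdp_prod_exp_XsubC.
have /dvdpP [B0 EB] : E %| B by exact: dvdp_prod_exp_XsubC.
have szq (p : {poly K}) : p != 0 -> size (p * E) = (size p + \sum_k e k)%N.
  by move=> nz; rewrite size_Mmonic // szE addnS.
set e' := (\sum_k e k)%N in bnd szE szq dvAB.
have sA0 : (size A0 <= j - e')%N.
  have [->|nz] := eqVneq A0 0; first by rewrite size_poly0.
  by rewrite EA szq // in szA; lia.
have sB0 : (size B0 <= j.+1 - e')%N.
  have [->|nz] := eqVneq B0 0; first by rewrite size_poly0.
  by rewrite EB szq // in szB; lia.
suff [A00 B00] : A0 = 0 /\ B0 = 0 by rewrite EA EB A00 B00 !mul0r.
case/orP: bnd => [lt_je|bnd].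
  by split; apply/eqP; rewrite -size_poly_leq0; lia.
(* The second alternative does not exclude j < e', as the subtraction is truncated. *)
have [lt_je|le_ej] := ltnP j e'.
  by split; apply/eqP; rewrite -size_poly_leq0; lia.
set N := (j - e')%N in sA0 dvAB bnd *; rewrite subSn // in sB0.
pose C := B0 + 'X^(N.+1) * A0.
have C0 : C = 0.
  apply/eqP/negPn/negP => nz.
  have : (size [seq t k | k <- enum act] < size C)%N.
    apply: max_poly_roots => //; last by rewrite map_inj_uniq ?enum_uniq.
    apply/allP => _ /mapP [k + ->]; rewrite mem_enum => k_act.
    have : ('X - (t k)%:P) ^+ (e k).+1 %| B + t k ^+ N.+1 *: A by exact: dvAB.
    (* The factors of E other than the k-th are coprime to X - t k, so cancelling (X - t k)^(e k)
       leaves a root of C at t k. *)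
    rewrite EA EB scalerAl -mulrDl /E (bigD1 k) //= mulrCA exprSr.
    rewrite dvdp_mul2l ?expf_neq0 ?polyXsubC_eq0 //.
    rewrite Gauss_dvdpl; last first.
      rewrite coprimep_sym coprimep_XsubC /root horner_prod prodf_seq_neq0.
      apply/allP => l _; apply/implyP => nlk; rewrite horner_exp expf_neq0 //.
      by rewrite !hornerE subr_eq0 eq_sym; apply: contra_neq nlk => /inj_t.
    by rewrite dvdp_XsubCl !rootE /C !hornerE.
  (* The size of C is at most 2N + 1, which does not exceed the number of roots. *)
  rewrite size_map -cardE ltnNge => /negP; apply; apply: leq_trans bnd.
  apply: leq_trans (size_polyD _ _) _; rewrite geq_max; apply/andP; split; first by lia.
  have [->|nz0] := eqVneq A0 0; first by rewrite mulr0 size_poly0.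
  by rewrite mulrC size_mulXn //; lia.
have A00 : A0 = 0.
  apply/polyP => i; rewrite coef0.
  have /(congr1 (fun p : {poly K} => p`_(i + N.+1))) := C0.
  rewrite coefD coefXnM ltnNge leq_addl /= addnK coef0 nth_default ?add0r //.
  by rewrite (leq_trans sB0) // leq_addl.
by split => //; rewrite -C0 /C A00 mulr0 addr0.
Qed.

(** * Openness of full rank *)

(** With B a left inverse at w0, take P = det (B M): it is 1 at w0, and wherever it is nonzero B M
    is invertible, so M still has a left inverse. *)
Lemma row_full_open (K : fieldType) (N m n : nat)
    (M : 'M[{mpoly K[N]}]_(m, n)) (w0 : 'I_N -> K) :
    row_full (map_mx (meval w0) M) ->
  exists2 P : {mpoly K[N]}, P.@[w0] != 0 &
    forall w, P.@[w] != 0 -> row_full (map_mx (meval w) M).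
Proof.
case/row_fullP => B BM; pose P := \det (map_mx (@mpolyC N K) B *m M).
have PE w : P.@[w] = \det (B *m map_mx (meval w) M).
  rewrite -det_map_mx map_mxM -map_mx_comp; congr (\det (_ *m _)).
  by apply/matrixP => i k; rewrite !mxE /= mevalC.
exists P => [|w]; first by rewrite PE BM det1 oner_eq0.
rewrite PE -unitfE -[_ \is a _]/(_ \in unitmx) => /mulVmx E.
by apply/row_fullP; exists (invmx (B *m map_mx (meval w) M) *m B); rewrite -mulmxA.
Qed.

(** * Monomials in three variables *)

Local Notation i0 := (@ord0 2).
Local Notation i1 := (lift (@ord0 2) (@ord0 1)).
Local Notation i2 := (lift (@ord0 2) (lift (@ord0 1) (@ord0 0))).

Definition mon3 (n b c : nat) : 'X_{1..3} :=
  (U_(i0) *+ (n - b - c) + U_(i1) *+ b + U_(i2) *+ c)%MM.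

Lemma mon3E0 n b c : mon3 n b c i0 = (n - b - c)%N.
Proof. by rewrite !mnmDE !mulmnE !mnm1E /=; lia. Qed.

Lemma mon3E1 n b c : mon3 n b c i1 = b.
Proof. by rewrite !mnmDE !mulmnE !mnm1E /=; lia. Qed.

Lemma mon3E2 n b c : mon3 n b c i2 = c.
Proof. by rewrite !mnmDE !mulmnE !mnm1E /=; lia. Qed.

Lemma mdeg3 (m : 'X_{1..3}) : mdeg m = (m i0 + m i1 + m i2)%N.
Proof. by rewrite mdegE !big_ord_recl big_ord0 addn0 addnA. Qed.

Lemma mdeg_mon3 n b c : (b + c <= n)%N -> mdeg (mon3 n b c) = n.
Proof. by rewrite mdeg3 mon3E0 mon3E1 mon3E2; lia. Qed.

Lemma mnm3P (m m' : 'X_{1..3}) :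
  m i0 = m' i0 -> m i1 = m' i1 -> m i2 = m' i2 -> m = m'.
Proof.
move=> e0 e1 e2; apply/mnmP => i.
case: (unliftP ord0 i) => [i'|] -> //; case: (unliftP ord0 i') => [i''|] -> //.
by rewrite ord1.
Qed.

(* Indexes the monomials of degree n.-1: the pair (c, b) stands for
   x^(n.-1 - b - c) y^b z^c. *)
Local Notation mon_index n := {c : 'I_n & 'I_(n - c)}.

Definition mon_of (n : nat) (u : mon_index n) : 'X_{1..3} :=
  mon3 n.-1 (tagged u) (tag u).
Arguments mon_of {n} u.

Lemma mon_of_inj n : injective (@mon_of n).
Proof.
case=> [c b] [c' b'] E.
have := congr1 (fun m : 'X_{1..3} => m i1) E; rewrite !mon3E1 /= => eb.
have := congr1 (fun m : 'X_{1..3} => m i2) E; rewrite !mon3E2 /= => ec.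
move: b b' eb {E}; rewrite (ord_inj ec) => b b' eb; congr Tagged; exact: ord_inj.
Qed.

Lemma mdeg_mon_of n (u : mon_index n) : mdeg (mon_of u) = n.-1.
Proof. by rewrite mdeg_mon3 //; case: u => [[c lt_c] [b /= lt_b]] /=; lia. Qed.

Lemma mon_ofP n (m : 'X_{1..3}) : mdeg m = n -> exists u : mon_index n.+1, m = mon_of u.
Proof.
rewrite mdeg3 => dm; have ltc : (m i2 < n.+1)%N by lia.
have ltb : (m i1 < n.+1 - Ordinal ltc)%N by move=> /=; lia.
exists (Tagged (fun c : 'I_n.+1 => 'I_(n.+1 - c)) (Ordinal ltb)).
apply: mnm3P; rewrite /mon_of ?mon3E0 ?mon3E1 ?mon3E2 //=. lia.
Qed.

Lemma card_sigT (I : finType) (T : I -> finType) :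
  #|{: {i : I & T i}}| = (\sum_i #|T i|)%N.
Proof. by rewrite card_tagged sumnE big_map big_enum. Qed.

(** Split off the exponents 0 and 1 of z: 2n + 1 is the dimension of R/(z^2) in degree n. *)
Lemma card_mon_index n : (0 < n)%N ->
  #|{: mon_index n.+1}| = (#|{: mon_index n.-1}| + n.*2.+1)%N.
Proof.
have cardE m : #|{: mon_index m}| = (\sum_(c < m) (m - c))%N.
  by rewrite card_sigT; apply: eq_bigr => c _; rewrite card_ord.
case: n => // n _; rewrite !cardE 2!big_ord_recl /=.
have -> : (\sum_(c < n) (n.+2 - bump 0 (bump 0 c)) = \sum_(c < n) (n - c))%N.
  by apply: eq_bigr => c _; rewrite /bump /= !add1n.
by rewrite /bump /=; lia.
Qed.

Lemma homog_mon_of_sum (R : nzRingType) n (h : {mpoly R[3]}) : h \is n.-homog ->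
  h = \sum_(u : mon_index n.+1) h@_(mon_of u) *: 'X_[mon_of u].
Proof.
move=> hh; apply/mpolyP => m; rewrite raddf_sum /=.
under eq_bigr do rewrite mcoeffZ mcoeffX.
have [dm|dm] := eqVneq (mdeg m) n; last first.
  rewrite (dhomog_nemf_coeff hh) // big1 // => u _.
  by case: eqP => [E|]; rewrite ?mulr0 //; rewrite -E mdeg_mon_of eqxx in dm.
have [u ->] := mon_ofP dm; rewrite (bigD1 u) //= eqxx mulr1 big1 ?addr0 // => v.
by rewrite (inj_eq (@mon_of_inj _)) => /negPf ->; rewrite mulr0.
Qed.

Lemma mnm_mdegS n m d : @mdeg n m = d.+1 ->
  exists i m', m = (U_(i) + m')%MM /\ mdeg m' = d.
Proof.
move=> dm; case: (pickP (fun i => m i != 0%N)) => [i mi | mE]; last first.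
  move: dm; rewrite mdegE big1 // => i _.
  by apply/eqP; have := mE i; case: eqP.
have Em : m = (U_(i) + (m - U_(i)))%MM by rewrite addmC submK // lep1mP.
exists i, (m - U_(i))%MM; split=> //.
by move: dm; rewrite {1}Em mdegD mdeg1 => -[].
Qed.

(** * Binary forms and division by a linear form *)

Section BinaryForms.
Context {K : fieldType}.
Implicit Types (p q : nat -> K) (n : nat).

(** Here n counts the coefficients: the degree is n.-1, and [binform p 0] is 0, which stands for
    forms of negative degree. *)
Definition binform p n : {mpoly K[3]} := \sum_(b < n) p b *: 'X_[mon3 n.-1 b 0].

Lemma binformD p q n : binform p n + binform q n = binform (fun b => p b + q b) n.
Proof. by rewrite -big_split; apply: eq_bigr => b _; rewrite scalerDl. Qed.

Lemma binformZ (c : K) p n : c *: binform p n = binform (fun b => c * p b) n.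
Proof. by rewrite scaler_sumr; apply: eq_bigr => b _; rewrite scalerA. Qed.

Lemma binformMX p n :
  'X_i0 * binform p n.+1 = binform (fun b => if (b <= n)%N then p b else 0) n.+2.
Proof.
rewrite /binform [RHS]big_ord_recr /= ltnn scale0r addr0 mulr_sumr.
apply: eq_bigr => b _; rewrite -ltnS ltn_ord -scalerAr -mpolyXD; congr (_ *: 'X_[_]).
apply: mnm3P; rewrite mnmDE mnm1E ?(mon3E0, mon3E1, mon3E2) //=.
by case: b => b /= lt_b; lia.
Qed.

Lemma binformMY p n :
  'X_i1 * binform p n = binform (fun b => if b is b'.+1 then p b' else 0) n.+1.
Proof.
rewrite /binform [RHS]big_ord_recl /= scale0r add0r mulr_sumr.
apply: eq_bigr => b _; rewrite -scalerAr -mpolyXD; congr (_ *: 'X_[_]).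
apply: mnm3P; rewrite mnmDE mnm1E ?(mon3E0, mon3E1, mon3E2) //=.
by case: b => b /= lt_b; rewrite /bump /=; lia.
Qed.

End BinaryForms.

Section ModuloLinearForm.
Context {K : fieldType} (l : 'I_3 -> K).
Hypothesis l_i2 : l i2 != 0.

Lemma linform3 (c : 'I_3 -> K) :
  linform c = c i0 *: 'X_i0 + c i1 *: 'X_i1 + c i2 *: 'X_i2.
Proof. by rewrite /linform !big_ord_recl big_ord0 addr0 addrA. Qed.

Lemma dhomog_linform (c : 'I_3 -> K) : linform c \is 1.-homog.
Proof. by apply: rpred_sum => i _; apply/rpredZ; rewrite dhomogX /= mdeg1. Qed.

Lemma dhomog_linformX (c : 'I_3 -> K) n : linform c ^+ n \is n.-homog.
Proof. by have := dhomogMn n (dhomog_linform c); rewrite mul1n. Qed.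

(** Division by [linform l] with a binary remainder. The last clause matters in degree 0, where n.-1
    is 0 again and would allow a constant quotient. *)
Let dec n (h : {mpoly K[3]}) := exists p h',
  [/\ h = binform p n.+1 + linform l * h', h' \is n.-1.-homog & n = 0%N -> h' = 0].

Let dec0 n : dec n 0.
Proof.
exists (fun=> 0), 0; split => //; last exact: rpred0.
by rewrite mulr0 addr0 /binform big1 // => b _; rewrite scale0r.
Qed.

Let decD n g h : dec n g -> dec n h -> dec n (g + h).
Proof.
move=> [p [g' [-> hg' g0]]] [q [h' [-> hh' h0]]].
exists (fun b => p b + q b), (g' + h'); split; last by move=> n0; rewrite g0 ?h0 ?addr0.
  by rewrite -binformD mulrDr addrACA.
exact: rpredD.
Qed.

Let decZ n c h : dec n h -> dec n (c *: h).
Proof.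
move=> [p [h' [-> hh' h0]]]; exists (fun b => c * p b), (c *: h').
by split; [rewrite -binformZ scalerDr scalerAr | exact: rpredZ | move/h0->; rewrite scaler0].
Qed.

Let homogMX n i (h : {mpoly K[3]}) :
  h \is n.-1.-homog -> (n = 0%N -> h = 0) -> 'X_i * h \is n.-homog.
Proof.
case: n => [_ ->|n hh _] //; first by rewrite mulr0 rpred0.
by rewrite -(add1n n); apply: dhomogM => //; rewrite dhomogX /= mdeg1.
Qed.

Let decMX n h : dec n h -> dec n.+1 ('X_i0 * h).
Proof.
move=> [p [h' [-> hh' h0]]]; rewrite mulrDr binformMX mulrCA.
by do 2!eexists; split; [reflexivity | exact: homogMX|].
Qed.

Let decMY n h : dec n h -> dec n.+1 ('X_i1 * h).
Proof.
move=> [p [h' [-> hh' h0]]]; rewrite mulrDr binformMY mulrCA.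
by do 2!eexists; split; [reflexivity | exact: homogMX|].
Qed.

Let decMZ n h : h \is n.-homog -> dec n h -> dec n.+1 ('X_i2 * h).
Proof.
move=> hh dh.
(* Solve for z in terms of x, y and [linform l]; the multiple of [linform l] goes into the
   quotient. *)
have -> : 'X_i2 * h = (l i2)^-1 *: (linform l * h + (- l i0) *: ('X_i0 * h)
    + (- l i1) *: ('X_i1 * h)).
  rewrite linform3 !mulrDl -!scalerAl !scaleNr.
  rewrite [X in _ *: X](_ : _ = l i2 *: ('X_i2 * h)); last by ring.
  by rewrite scalerA mulVf // scale1r.
apply/decZ/decD; last exact/decZ/decMY.
apply: decD; last exact/decZ/decMX.
exists (fun=> 0), h; split=> //.
by rewrite /binform big1 ?add0r // => b _; rewrite scale0r.
Qed.

Let decX n (m : 'X_{1..3}) : mdeg m = n -> dec n 'X_[m].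
Proof.
elim: n m => [|n IH] m dm.
  move/eqP: dm; rewrite mdeg_eq0 => /eqP ->; exists (fun=> 1), 0; split=> //.
    rewrite mulr0 addr0 /binform big_ord1 scale1r; congr 'X_[_].
    by apply: mnm3P; rewrite ?(mon3E0, mon3E1, mon3E2) mnm0E.
  exact: rpred0.
have [i [m' [-> dm']]] := mnm_mdegS dm; rewrite mpolyXD.
have {IH} dec' := IH m' dm'.
case: (unliftP ord0 i) => [i'|] ->; last exact: decMX.
case: (unliftP ord0 i') => [i''|] ->; last exact: decMY.
by rewrite ord1; apply: decMZ => //; rewrite dhomogX /= dm'.
Qed.

Lemma mod_linform n (h : {mpoly K[3]}) : h \is n.-homog -> exists p h',
  [/\ h = binform p n.+1 + linform l * h', h' \is n.-1.-homog & n = 0%N -> h' = 0].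
Proof.
move=> hh; rewrite [h]mpolyE big_seq.
apply: (big_ind (dec n)) => [||m m_h]; [exact: dec0 | exact: decD | apply: decZ].
by apply: decX; exact: (dhomog_mf hh m_h).
Qed.

Lemma mod_linform_sqr n (h : {mpoly K[3]}) : h \is n.-homog -> exists p q r,
  [/\ h = binform p n.+1 + linform l * binform q n + linform l ^+ 2 * r,
      r \is n.-2.-homog & (n < 2)%N -> r = 0].
Proof.
move=> /mod_linform [p [h' [-> hh' h0]]]; case: n => [|n] in hh' h0 *.
  exists p, (fun=> 0), 0; split=> //; last exact: rpred0.
  by rewrite h0 // /(binform _ 0) big_ord0 !mulr0 !addr0.
have [q [r [-> hr r0]]] := mod_linform hh'; exists p, q, r; split=> //.
  by rewrite mulrDr mulrA -expr2 addrA.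
by case: n {hh' h0 hr} r0 => // r0 _; exact: r0.
Qed.

End ModuloLinearForm.

(** * The matrix of the ideal in one degree *)

Section Rows.
Context {A : comNzRingType} {J : finType} (a : J -> nat) (j : nat).

(** A copy of [linform] over any commutative ring, so that the coefficients can be
    indeterminates. *)
Definition genform (c : 'I_3 -> A) : {mpoly A[3]} := \sum_(i < 3) c i *: 'X_i.

(** Truncated subtraction gives no rows to k with a k > j, and none to the square of l0 when j <
    2. *)
Definition row_index : finType :=
  ({k : J & 'I_(j.+1 - a k)} + {k : J & 'I_(j - a k)} + mon_index j.-1)%type.

(* Modulo l0 ^+ 2, the forms of degree e are generated by the x^(e-b) y^b and
   the l0 x^(e-1-b) y^b as soon as z occurs in l0; hence these rows generate the
   degree j part of the ideal (l0 ^+ 2, l k ^+ a k). *)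
Definition ideal_row (l0 : 'I_3 -> A) (l : J -> 'I_3 -> A) (i : row_index) : {mpoly A[3]} :=
  match i with
  | inl (inl u) => genform (l (tag u)) ^+ a (tag u) *
                     'X_[mon3 (j - a (tag u)) (tagged u) 0]
  | inl (inr u) => genform (l (tag u)) ^+ a (tag u) *
                     (genform l0 * 'X_[mon3 (j - a (tag u)).-1 (tagged u) 0])
  | inr u => genform l0 ^+ 2 * 'X_[mon_of u]
  end.

Definition ideal_mx (l0 : 'I_3 -> A) (l : J -> 'I_3 -> A) : 'M[A]_(#|row_index|, #|{: mon_index j.+1}|) :=
  \matrix_(i, u) (ideal_row l0 l (enum_val i))@_(mon_of (enum_val u)).

End Rows.

Section RowsMap.
Context {A B : comNzRingType} (f : {rmorphism A -> B}).

Lemma map_genform (c : 'I_3 -> A) : map_mpoly f (genform c) = genform (f \o c).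
Proof.
by rewrite rmorph_sum; apply: eq_bigr => i _; rewrite /= map_mpolyZ map_mpolyX.
Qed.

(** With f an evaluation, a matrix with polynomial entries specialises to the matrix at a point,
    which brings [row_full_open] to bear. *)
Lemma map_ideal_mx (J : finType) (a : J -> nat) j l0 (l : J -> 'I_3 -> A) :
  map_mx f (ideal_mx a j l0 l) = ideal_mx a j (f \o l0) (fun k => f \o l k).
Proof.
apply/matrixP => i u; rewrite !mxE -mcoeff_map_mpoly; congr (_@__).
by case: (enum_val i) => [[]|] v /=; rewrite !(rmorphM, rmorphXn) /= ?map_genform map_mpolyX.
Qed.

End RowsMap.

Section RowsField.
Context {K : fieldType} {J : finType} (a : J -> nat) (j : nat).
Variables (l0 : 'I_3 -> K) (l : J -> 'I_3 -> K).
Local Notation row := (ideal_row (a := a) (j := j) l0 l).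
Local Notation mx := (ideal_mx a j l0 l).
Local Notation row_index := (row_index a j).

Lemma dhomog_ideal_row i : row i \is j.-homog.
Proof.
have dM b n (m : 'X_{1..3}) (c : 'I_3 -> K) :
    mdeg m = n -> (b + n)%N = j -> linform c ^+ b * 'X_[m] \is j.-homog.
  by move=> dm <-; apply: dhomogM; rewrite ?dhomog_linformX // dhomogX /= dm.
case: i => [[[k [b ltb]]|[k [b /= ltb]]]|u] /=.
- by apply: dM; [apply: mdeg_mon3|]; lia.
- rewrite [genform _ * _]mulrC mulrA mulrC.
  have -> : j = (1 + j.-1)%N by lia.
  rewrite -[genform l0]expr1; apply: dhomogM; first exact: dhomog_linformX.
  have -> : j.-1 = (a k + (j - a k).-1)%N by lia.
  by apply: dhomogM; [exact: dhomog_linformX|rewrite dhomogX /= mdeg_mon3 //; lia].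
- by apply: dM; [exact: mdeg_mon_of|]; case: u => [[c ltc] b] /=; lia.
Qed.

Lemma sum_ideal_row_mx (c : row_index -> K) v :
  (\sum_i c i *: row i)@_(mon_of v) =
  ((\row_i c (enum_val i)) *m mx) 0 (enum_rank v).
Proof.
rewrite raddf_sum /= big_enum_val mxE; apply: eq_bigr => i _.
by rewrite mcoeffZ !mxE enum_rankK.
Qed.

Lemma row_full_span (h : {mpoly K[3]}) : row_full mx -> h \is j.-homog ->
  exists c : row_index -> K, h = \sum_i c i *: row i.
Proof.
case/row_fullP => B BM hh.
pose hv := \row_u h@_(mon_of (enum_val u)) : 'rV_#|{: mon_index j.+1}|.
pose c i := (hv *m B) 0 (enum_rank i); exists c.
have hc : \sum_i c i *: row i \is j.-homog.
  by apply: rpred_sum => i _; apply/rpredZ/dhomog_ideal_row.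
rewrite (homog_mon_of_sum hh) (homog_mon_of_sum hc); apply: eq_bigr => u _.
congr (_ *: _); rewrite sum_ideal_row_mx.
rewrite (_ : \row_i _ = hv *m B); last by apply/rowP => i; rewrite mxE /c enum_valK.
by rewrite -mulmxA BM mulmx1 mxE enum_rankK.
Qed.

Lemma row_full_free (c : row_index -> K) :
    row_full mx -> #|row_index| = #|{: mon_index j.+1}| ->
    \sum_i c i *: row i = 0 -> forall i, c i = 0.
Proof.
move=> full sq c0 i.
have free : row_free mx by move: full; rewrite /row_free /row_full => /eqP ->; rewrite sq.
have : (\row_i c (enum_val i)) *m mx = 0.
  apply/rowP => u; rewrite -(enum_valK u) -sum_ideal_row_mx c0 mxE.
  by rewrite mcoeff0.
rewrite -[X in _ = X](mul0mx _ mx) => /(row_free_inj free) /rowP /(_ (enum_rank i)).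
by rewrite !mxE enum_rankK.
Qed.

(** A vector killed by the transposed matrix is a functional on the forms of degree j that vanishes
    on every row. *)
Lemma row_full_dual :
    (forall u : mon_index j.+1 -> K,
      (forall i, \sum_v u v * (row i)@_(mon_of v) = 0) -> forall v, u v = 0) ->
  row_full mx.
Proof.
move=> dual0; rewrite /row_full -mxrank_tr; apply: inj_row_free => w w0.
apply/rowP => v; rewrite [RHS]mxE -(enum_valK v).
apply: (dual0 (fun v => w 0 (enum_rank v))) => i.
have /rowP /(_ (enum_rank i)) := w0; rewrite !mxE => E.
rewrite -[RHS]E big_enum_val; apply: eq_bigr => u _.
by rewrite !mxE !enum_valK enum_rankK.
Qed.

(** The coefficients are returned along with the combination, so that independence of the rows can
    later force p and q to vanish. *)
Lemma ideal_row_comb (p q : J -> nat -> K) (r : {mpoly K[3]}) :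
    r \is j.-2.-homog -> ((j < 2)%N -> r = 0) ->
  exists2 c : row_index -> K,
    \sum_i c i *: row i =
      \sum_k linform (l k) ^+ a k *
        (binform (p k) (j.+1 - a k) + linform l0 * binform (q k) (j - a k))
      + linform l0 ^+ 2 * r &
    (forall u, c (inl (inl u)) = p (tag u) (tagged u)) /\
    (forall u, c (inl (inr u)) = q (tag u) (tagged u)).
Proof.
move=> hr r0.
exists (fun i : row_index => match i with
  | inl (inl u) => p (tag u) (tagged u)
  | inl (inr u) => q (tag u) (tagged u)
  | inr u => r@_(mon_of u) end); last by [].
rewrite !big_sumType /=; congr (_ + _); last first.
  case: (ltnP j 2) => [lt_j2|le_2j].
    rewrite r0 // mulr0 big1 // => u _; by rewrite mcoeff0 scale0r.
  rewrite [in RHS](homog_mon_of_sum hr) mulr_sumr.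
  have -> : j.-2.+1 = j.-1 by lia.
  by apply: eq_bigr => u _; rewrite scalerAr.
under [RHS]eq_bigr => k _ do rewrite mulrDr.
rewrite big_split /=; congr (_ + _).
  rewrite (eq_bigr (fun k => \sum_(b < j.+1 - a k)
    p k b *: (linform (l k) ^+ a k * 'X_[mon3 (j - a k) b 0]))) => [|k _].
    by rewrite sig_big_dep.
  rewrite mulr_sumr; apply: eq_bigr => b _; rewrite scalerAr.
  by have -> : (j.+1 - a k).-1 = (j - a k)%N by lia.
rewrite (eq_bigr (fun k => \sum_(b < j - a k)
    q k b *: (linform (l k) ^+ a k * (linform l0 * 'X_[mon3 (j - a k).-1 b 0])))) => [|k _].
  by rewrite sig_big_dep.
rewrite mulr_sumr mulr_sumr; apply: eq_bigr => b _.
by rewrite -!scalerAr.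
Qed.

End RowsField.

(** * Expansions of powers of linear forms *)

(** This expansion, after a further factor z, and the next one serve for y a multiple of z. The
    functional below kills z^2 times a form of degree j - 2, hence the control on the degree of
    r. *)
Lemma exprD_mod1 (R : comNzRingType) (x y : {mpoly R[3]}) n :
    x \is 1.-homog -> y \is 1.-homog ->
  exists r, [/\ (x + y) ^+ n = x ^+ n + y * r, r \is n.-1.-homog & n = 0%N -> r = 0].
Proof.
move=> hx hy; elim: n => [|n [r [E hr r0]]].
  by exists 0; split; rewrite ?rpred0 // !expr0 mulr0 addr0.
exists (x ^+ n + (x + y) * r); split=> //; first by rewrite exprS E exprS; ring.
apply: rpredD; first by have := dhomogMn n hx; rewrite mul1n.
case: n {E} r0 hr => [->|n _ hr] //; first by rewrite mulr0 rpred0.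
by rewrite -[n.+1.+1.-1](add1n n); apply: dhomogM => //; exact: rpredD.
Qed.

Lemma exprD_mod2 (R : comNzRingType) (x y : {mpoly R[3]}) n :
    x \is 1.-homog -> y \is 1.-homog ->
  exists r, [/\ (x + y) ^+ n = x ^+ n + x ^+ n.-1 * y *+ n + y ^+ 2 * r,
                r \is n.-2.-homog & (n < 2)%N -> r = 0].
Proof.
move=> hx hy; case: n => [|n].
  by exists 0; split; rewrite ?rpred0 // !expr0 mulr0n !addr0 mulr0 addr0.
elim: n => [|n [r [E hr r0]]].
  by exists 0; split; rewrite ?rpred0 // !expr1 expr0 mulr0 mul1r addr0.
exists (x ^+ n *+ n.+1 + (x + y) * r); split=> //.
  by rewrite exprS E !exprS !mulrS /=; ring.
apply: rpredD; first by apply: rpredMn; have := dhomogMn n hx; rewrite mul1n.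
case: n {E} r0 hr => [->|n _ hr] //; first by rewrite mulr0 rpred0.
by rewrite -[n.+1.+2.-2](add1n n); apply: dhomogM => //; exact: rpredD.
Qed.

Lemma expr_binform (K : fieldType) (T : K) n :
  ('X_i0 + T *: 'X_i1) ^+ n = binform (fun b => T ^+ b *+ 'C(n, b)) n.+1.
Proof.
rewrite exprDn; apply: eq_bigr => b _; rewrite exprZn -scalerAr scalerMnl.
congr (_ *: _); rewrite !mpolyXn -mpolyXD; congr 'X_[_].
by apply: mnm3P; rewrite mnmDE !mulmnE !mnm1E ?(mon3E0, mon3E1, mon3E2) /=; lia.
Qed.

Definition point3 {A : nzRingType} (t c : A) : 'I_3 -> A :=
  fun i => if i == i0 then 1 else if i == i1 then t else c.

Definition zcoef {A : nzRingType} : 'I_3 -> A := fun i => (i == i2)%:R.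

Lemma linform_point3 (K : fieldType) (t c : K) :
  linform (point3 t c) = 'X_i0 + t *: 'X_i1 + c *: 'X_i2.
Proof. by rewrite linform3 /point3 /= scale1r. Qed.

Lemma linform_zcoef (K : fieldType) : linform (@zcoef K) = 'X_i2.
Proof. by rewrite linform3 /zcoef /= !scale0r !add0r scale1r. Qed.

(** * Functionals vanishing on the rows *)

Section Witness.
Context {K : fieldType} {J : finType} (a : J -> nat) (j : nat).
Hypotheses (charK : [pchar K] =i pred0) (j_gt0 : (0 < j)%N).
Variables (t c : J -> K).
Local Notation l k := (point3 (t k) (c k)).
Variable u : mon_index j.+1 -> K.

Let phi (f : {mpoly K[3]}) : K := \sum_v u v * f@_(mon_of v).

Hypothesis phi_row : forall i : row_index a j, phi (ideal_row zcoef (fun k => l k) i) = 0.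

Let phiD f g : phi (f + g) = phi f + phi g.
Proof. by rewrite -big_split; apply: eq_bigr => v _; rewrite mcoeffD mulrDr. Qed.

Let phiZ x f : phi (x *: f) = x * phi f.
Proof. by rewrite mulr_sumr; apply: eq_bigr => v _; rewrite mcoeffZ mulrCA. Qed.

Let phi_sum (I : finType) (F : I -> {mpoly K[3]}) : phi (\sum_i F i) = \sum_i phi (F i).
Proof.
apply: (big_morph phi phiD).
by rewrite /phi big1 // => v _; rewrite mcoeff0 mulr0.
Qed.

Let phiMn n f : phi (f *+ n) = phi f *+ n.
Proof. by rewrite -scaler_nat phiZ mulr_natl. Qed.

Let phi_mon v : phi 'X_[mon_of v] = u v.
Proof.
rewrite /phi (bigD1 v) //= mcoeffX eqxx mulr1 big1 ?addr0 // => w /negPf nwv.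
by rewrite mcoeffX (inj_eq (@mon_of_inj _)) eq_sym nwv mulr0.
Qed.

Let phi_comb (d : row_index a j -> K) :
  phi (\sum_i d i *: ideal_row zcoef (fun k => l k) i) = 0.
Proof. by rewrite phi_sum big1 // => i _; rewrite phiZ phi_row mulr0. Qed.

Let phi_z2 r : r \is j.-2.-homog -> ((j < 2)%N -> r = 0) -> phi ('X_i2 ^+ 2 * r) = 0.
Proof.
move=> hr r0.
have [d E _] := ideal_row_comb a zcoef (fun k => l k) (fun _ _ => 0) (fun _ _ => 0) hr r0.
rewrite -(phi_comb d) E linform_zcoef big1 ?add0r // => k _.
by rewrite /binform !big1 ?mulr0 ?addr0 ?mulr0 // => b _; rewrite scale0r.
Qed.

(** Modulo z^2 the cofactor h is a binary form plus z times another, which the rows of L_k cover;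
    the multiple of z^2 falls to the rows of z^2. *)
Let phi_power k h : (a k <= j)%N -> h \is (j - a k).-homog ->
  phi (linform (l k) ^+ a k * h) = 0.
Proof.
move=> le_aj /(mod_linform_sqr (l := zcoef)) [|p [q [r [-> hr r0]]]].
  exact: oner_neq0.
have hr' : linform (l k) ^+ a k * r \is j.-2.-homog.
  have [lt2|le2] := ltnP (j - a k) 2; first by rewrite r0 // mulr0 rpred0.
  have -> : j.-2 = (a k + (j - a k).-2)%N by lia.
  by apply: dhomogM => //; exact: dhomog_linformX.
have r0' : (j < 2)%N -> linform (l k) ^+ a k * r = 0.
  by move=> lt2; rewrite r0 ?mulr0 //; lia.
have [d E _] := ideal_row_comb a zcoef (fun k => l k)
  (fun i => if i == k then p else fun=> 0) (fun i => if i == k then q else fun=> 0) hr' r0'.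
rewrite -(phi_comb d) E; congr phi; rewrite (bigD1 k) //= eqxx subSn //.
rewrite big1 ?addr0 => [|i /negPf ->]; last first.
  by rewrite /binform !big1 ?mulr0 ?addr0 ?mulr0 // => b _; rewrite scale0r.
by rewrite mulrDr mulrCA.
Qed.

(** At T, pB and pA take the values phi((x + T y)^j) and j phi(z (x + T y)^(j - 1)). As phi kills
    z^2, pB + c pA takes the value phi((x + T y + c z)^j). *)
Let pB : {poly K} := \poly_(b < j.+1) (phi 'X_[mon3 j b 0] *+ 'C(j, b)).
Let pA : {poly K} := \poly_(b < j) (phi ('X_i2 * 'X_[mon3 j.-1 b 0]) *+ 'C(j.-1, b) *+ j).

Let pB_horner T : pB.[T] = phi (('X_i0 + T *: 'X_i1) ^+ j).
Proof.
rewrite horner_poly expr_binform phi_sum; apply: eq_bigr => b _.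
by rewrite phiZ mulrnAl mulrnAl mulrC.
Qed.

Let pA_horner T : pA.[T] = phi ('X_i2 * ('X_i0 + T *: 'X_i1) ^+ j.-1) *+ j.
Proof.
rewrite horner_poly expr_binform mulr_sumr phi_sum prednK // -sumrMnl.
apply: eq_bigr => b _.
by rewrite -scalerAr phiZ !mulrnAl mulrC.
Qed.

Let homX i : ('X_i : {mpoly K[3]}) \is 1.-homog.
Proof. by rewrite dhomogX /= mdeg1. Qed.

Let hom_xy (T : K) : 'X_i0 + T *: 'X_i1 \is 1.-homog.
Proof. by apply: rpredD; [|apply: rpredZ]; exact: homX. Qed.

(** Write x + T y + c_k z as L_k + (T - t_k) y. The coefficient of (T - t_k)^r involves L_k^(j - r),
    a multiple of L_k^(a_k) for r <= j - a_k, so phi kills it. *)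
Let dvd_pAB k : (a k <= j)%N -> ('X - (t k)%:P) ^+ (j - a k).+1 %| pB + c k *: pA.
Proof.
move=> le_aj.
apply: (@dvdp_exp_XsubC_taylor _ _ (t k) (j - a k).+1 j.+1
  (fun r => phi (linform (l k) ^+ (j - r) * 'X_i1 ^+ r) *+ 'C(j, r))) => // [r lt_r|T].
  have -> : (j - r = a k + (j - a k - r))%N by lia.
  rewrite exprD -mulrA phi_power ?mul0rn //.
  have {2}-> : (j - a k = (j - a k - r) + r)%N by lia.
  apply: dhomogM; first exact: dhomog_linformX.
  by have := dhomogMn r (homX i1); rewrite mul1n.
have [r [E hr r0]] := exprD_mod2 j (hom_xy T) (rpredZ (c k) (homX i2)).
transitivity (phi (('X_i0 + T *: 'X_i1 + c k *: 'X_i2) ^+ j)).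
  rewrite E !phiD exprZn -scalerAl phiZ phi_z2 // mulr0 addr0.
  by rewrite hornerD hornerZ pB_horner pA_horner phiMn -scalerAr phiZ mulrnAr [_ * 'X_i2]mulrC.
have -> : 'X_i0 + T *: 'X_i1 + c k *: 'X_i2 = linform (l k) + (T - t k) *: 'X_i1.
  by rewrite linform_point3 scalerBl; ring.
rewrite exprDn phi_sum; apply: eq_bigr => b _.
by rewrite phiMn exprZn -scalerAr phiZ mulrnAl mulrC.
Qed.

(** The factor z hides c_k z modulo z^2, so the same expansion applies to pA alone, with power j - 1
    and one order of vanishing less. *)
Let dvd_pA k : ('X - (t k)%:P) ^+ (j - a k) %| pA.
Proof.
apply: (@dvdp_exp_XsubC_taylor _ _ (t k) (j - a k) j
  (fun r => phi ('X_i2 * (linform (l k) ^+ (j.-1 - r) * 'X_i1 ^+ r)) *+ 'C(j.-1, r) *+ j))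
  => // [r lt_r|T].
  have -> : (j.-1 - r = a k + (j.-1 - a k - r))%N by lia.
  have le_aj : (a k <= j)%N by lia.
  rewrite exprD -mulrA mulrCA phi_power ?mul0rn //.
  have -> : (j - a k = 1 + ((j.-1 - a k - r) + r))%N by lia.
  apply: dhomogM; first exact: homX.
  apply: dhomogM; first exact: dhomog_linformX.
  by have := dhomogMn r (homX i1); rewrite mul1n.
have [r [E hr r0]] := exprD_mod1 j.-1 (hom_xy T) (rpredZ (c k) (homX i2)).
transitivity (phi ('X_i2 * ('X_i0 + T *: 'X_i1 + c k *: 'X_i2) ^+ j.-1) *+ j).
  rewrite E mulrDr phiD mulrA -scalerAr -scalerAl phiZ -expr2 phi_z2 ?mulr0 ?addr0 //.
  by move=> lt2; apply: r0; lia.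
have -> : 'X_i0 + T *: 'X_i1 + c k *: 'X_i2 = linform (l k) + (T - t k) *: 'X_i1.
  by rewrite linform_point3 scalerBl; ring.
rewrite exprDn mulr_sumr phi_sum prednK // -sumrMnl; apply: eq_bigr => b _.
by rewrite mulrnAr phiMn exprZn -!scalerAr phiZ !mulrnAl mulrC.
Qed.

Lemma functional_eq0 :
    injective t -> (forall k, c k = t k ^+ (j - \sum_k (j - a k)).+1) ->
    (j < \sum_k (j - a k))%N
      || ((j - \sum_k (j - a k)).*2 < #|[set k | (a k <= j)%N]|)%N ->
  forall v, u v = 0.
Proof.
move=> inj_t Ec bnd.
have [A0 B0] : pA = 0 /\ pB = 0.
  apply: (@paired_interpolation _ _ [set k | (a k <= j)%N] t (fun k => j - a k)%N j) => //.
  - exact: size_poly.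
  - exact: size_poly.
  - move=> k; case: (leqP (a k) j) => [le_aj|lt_ja].
      rewrite -(dvdp_addl _ (_ : _ %| c k *: pA)); last first.
        by rewrite -mul_polyC; apply: dvdp_mull; exact: dvd_pA.
      by apply: dvdp_trans (dvd_pAB le_aj); exact: dvdp_exp2l.
    have -> : (j - a k = 0)%N by lia.
    by rewrite expr0 dvd1p.
  - by move=> k; rewrite inE -Ec; exact: dvd_pAB.
have mulrn0 (x : K) n : (0 < n)%N -> x *+ n = 0 -> x = 0.
  move=> n_gt0 /eqP; rewrite -mulr_natr mulf_eq0 (proj1 (pcharf0P K) charK).
  by rewrite eqn0Ngt n_gt0 orbF => /eqP.
(* For exponent 0 or 1 of z the value is a coefficient of pB or pA up to factors that are invertible
   in characteristic zero; from exponent 2 on [phi_z2] applies. *)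
case=> [[[|[|cz]] ltc] [b /= ltb]]; rewrite -phi_mon /mon_of /=.
- have /(congr1 (fun p : {poly K} => p`_b)) := B0.
  rewrite coef0 coef_poly ltb => /mulrn0; apply; rewrite bin_gt0; lia.
- have /(congr1 (fun p : {poly K} => p`_b)) := A0.
  have ltb' : (b < j)%N by lia.
  rewrite coef0 coef_poly ltb' => /(mulrn0 _ _ j_gt0) /mulrn0 E.
  rewrite -[RHS]E ?bin_gt0; last by lia.
  congr phi; rewrite -mpolyXD; congr 'X_[_].
  by apply: mnm3P; rewrite mnmDE mnm1E ?(mon3E0, mon3E1, mon3E2) /=; lia.
have -> : ('X_[mon3 j b cz.+2] : {mpoly K[3]}) = 'X_i2 ^+ 2 * 'X_[mon3 j.-2 b cz].
  rewrite mpolyXn -mpolyXD; congr 'X_[_].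
  by apply: mnm3P; rewrite mnmDE mulmnE mnm1E ?(mon3E0, mon3E1, mon3E2) /=; lia.
apply: phi_z2 => [|lt2]; last by lia.
by rewrite dhomogX /= mdeg_mon3 //; lia.
Qed.

End Witness.

Lemma witness_row_full (K : fieldType) (J : finType) (a : J -> nat) (j : nat) :
    [pchar K] =i pred0 -> (0 < j)%N ->
    (j < \sum_k (j - a k))%N
      || ((j - \sum_k (j - a k)).*2 < #|[set k | (a k <= j)%N]|)%N ->
  exists t c : J -> K, row_full (ideal_mx a j zcoef (fun k => point3 (t k) (c k))).
Proof.
move=> charK j_gt0 bnd; pose t (k : J) : K := (enum_rank k)%:R.
exists t, (fun k => t k ^+ (j - \sum_k (j - a k)).+1).
apply: row_full_dual => u u0; apply: (functional_eq0 charK j_gt0 u0) => //.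
by move=> k k' /(natr_inj_pchar0 charK) /ord_inj /enum_rank_inj.
Qed.

(** * Ideals and homogeneous components *)

Section Ideals.
Context {K : fieldType} {n m : nat} (g : 'I_m -> {mpoly K[n]}).

Lemma in_ideal0 : in_ideal g 0.
Proof. by exists (fun=> 0); rewrite big1 // => k _; rewrite mul0r. Qed.

Lemma in_idealD f f' : in_ideal g f -> in_ideal g f' -> in_ideal g (f + f').
Proof.
move=> [h ->] [h' ->]; exists (fun k => h k + h' k).
by rewrite -big_split; apply: eq_bigr => k _; rewrite mulrDl.
Qed.

Lemma in_idealM q f : in_ideal g f -> in_ideal g (q * f).
Proof.
move=> [h ->]; exists (fun k => q * h k).
by rewrite mulr_sumr; apply: eq_bigr => k _; rewrite mulrA.
Qed.

Lemma in_idealZ x f : in_ideal g f -> in_ideal g (x *: f).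
Proof. by rewrite -mul_mpolyC; exact: in_idealM. Qed.

Lemma in_ideal_sum (I : Type) (r : seq I) (P : pred I) F :
  (forall i, P i -> in_ideal g (F i)) -> in_ideal g (\sum_(i <- r | P i) F i).
Proof.
by move=> gF; apply: (big_ind (in_ideal g)) => //; [exact: in_ideal0 | exact: in_idealD].
Qed.

Lemma in_ideal_gen k : in_ideal g (g k).
Proof.
exists (fun k' => (k' == k)%:R); rewrite (bigD1 k) //= eqxx mul1r big1 ?addr0 //.
by move=> k' /negPf ->; rewrite mul0r.
Qed.

Lemma in_ideal_gt_degree D d :
    (forall h, h \is D.-homog -> in_ideal g h) -> (D <= d)%N ->
  forall h, h \is d.-homog -> in_ideal g h.
Proof.
move=> gD /subnK <-; elim: (d - D)%N => [|e IH] // h hh.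
rewrite [h]mpolyE big_seq; apply: in_ideal_sum => m' m'h; apply: in_idealZ.
have [i [m'' [-> dm'']]] := mnm_mdegS (dhomog_mf hh m'h : mdeg m' = (e + D).+1).
by rewrite mpolyXD; apply/in_idealM/IH; rewrite dhomogX /= dm''.
Qed.

Lemma pihomogM_homog (h p : {mpoly K[n]}) b j : p \is b.-homog ->
  pihomog mdeg j (h * p) = (if (b <= j)%N then pihomog mdeg (j - b) h else 0) * p.
Proof.
move=> hp; rewrite [h in LHS](@pihomog_partitionE _ _ mdeg (maxn (msize h) j.+1)); last first.
  exact: leq_maxl.
have homM e : pihomog mdeg e h * p \is (e + b).-homog by exact/dhomogM/hp/pihomogP.
rewrite mulr_suml raddf_sum /=; case: leqP => [le_bj|lt_jb].
  have lt_jb : (j - b < maxn (msize h) j.+1)%N by rewrite leq_max; apply/orP; right; lia.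
  rewrite (bigD1 (Ordinal lt_jb)) //= big1 ?addr0 => [|e ne].
    by rewrite pihomog_dE //; have := homM (j - b)%N; rewrite subnK.
  rewrite (pihomog_ne0 _ (homM e)) //; apply: contraNneq ne => E.
  by apply/eqP/val_inj => /=; lia.
rewrite mul0r big1 // => e _; rewrite (pihomog_ne0 _ (homM e)) //.
by apply/eqP; lia.
Qed.

(** Take the component of degree j - b k of each cofactor; for b k > j it has to be 0, since the
    truncated degree would admit constants. *)
Lemma in_ideal_homog (b : 'I_m -> nat) j f :
    (forall k, g k \is (b k).-homog) -> f \is j.-homog -> in_ideal g f ->
  exists h : 'I_m -> {mpoly K[n]}, f = \sum_k h k * g k /\
    forall k, h k \is (j - b k).-homog /\ ((j < b k)%N -> h k = 0).
Proof.
move=> hg hf [h Ef].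
exists (fun k => if (b k <= j)%N then pihomog mdeg (j - b k) (h k) else 0); split.
  rewrite -(pihomog_dE hf) Ef raddf_sum; apply: eq_bigr => k _.
  exact: pihomogM_homog.
by move=> k; case: leqP => _; split=> //; [exact: pihomogP | exact: rpred0].
Qed.

End Ideals.

(** * Consequences of full rank *)

(** By comparison with [card_mon_index], for j > 0 the matrix is square exactly when twice the sum
    of the j - a k plus the number of k with a k <= j is 2j + 1. *)
Lemma card_row_index (J : finType) (a : J -> nat) j :
  #|row_index a j| = (\sum_k (j - a k) + \sum_k (a k <= j)%N + \sum_k (j - a k)
                      + #|{: mon_index j.-1}|)%N.
Proof.
have -> : (\sum_k (j - a k) + \sum_k (a k <= j) = \sum_k (j.+1 - a k))%N.
  by rewrite -big_split; apply: eq_bigr => k _ /=; case: leqP => le_aj; lia.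
rewrite 2!card_sum 2!card_sigT; congr (_ + _ + _)%N.
  by apply: eq_bigr => k _; rewrite card_ord.
by apply: eq_bigr => k _; rewrite card_ord.
Qed.

Section FullRank.
Context {K : fieldType} {J : finType} (a : J -> nat) (j : nat).
Variables (l0 : 'I_3 -> K) (l : J -> 'I_3 -> K).
Hypothesis full : row_full (ideal_mx a j l0 l).

Lemma row_full_in_ideal m (g : 'I_m -> {mpoly K[3]}) :
    in_ideal g (linform l0 ^+ 2) ->
    (forall k, (a k <= j)%N -> in_ideal g (linform (l k) ^+ a k)) ->
  forall h, h \is j.-homog -> in_ideal g h.
Proof.
move=> g0 gk h /(row_full_span full) [c ->]; apply: in_ideal_sum => i _.
apply: in_idealZ; case: i => [[[k b]|[k b]]|u] /=; rewrite mulrC; apply: in_idealM => //;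
  by apply: gk; case: b => b /= ltb; lia.
Qed.

(** In the square case full rank makes the rows independent. Dividing each H k by the square of l0
    turns the syzygy into a relation between rows, so all remainders vanish. *)
Lemma row_full_syzygy (H : J -> {mpoly K[3]}) (G : {mpoly K[3]}) :
    l0 i2 != 0 -> #|row_index a j| = #|{: mon_index j.+1}| ->
    (forall k, H k \is (j - a k).-homog /\ ((j < a k)%N -> H k = 0)) ->
    G \is j.-2.-homog -> ((j < 2)%N -> G = 0) ->
    \sum_k linform (l k) ^+ a k * H k + linform l0 ^+ 2 * G = 0 ->
  forall k, exists r : {mpoly K[3]}, H k = linform l0 ^+ 2 * r.
Proof.
move=> nz_l0 sq hH hG G0 syz.
have dec k : exists x : (nat -> K) * (nat -> K) * {mpoly K[3]},
    [/\ H k = binform x.1.1 (j.+1 - a k) + linform l0 * binform x.1.2 (j - a k)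
              + linform l0 ^+ 2 * x.2,
        linform (l k) ^+ a k * x.2 \is j.-2.-homog &
        (j < 2)%N -> linform (l k) ^+ a k * x.2 = 0].
  have [hHk Hk0] := hH k; have [le_aj|lt_ja] := leqP (a k) j; last first.
    exists (fun=> 0, fun=> 0, 0); rewrite Hk0 // !mulr0 rpred0 addr0; split=> //.
    by rewrite /binform !big1 ?mulr0 ?addr0 // => b _; rewrite scale0r.
  have [p [q [r [-> hr r0]]]] := mod_linform_sqr nz_l0 hHk.
  exists (p, q, r); rewrite subSn //; split=> //= [|lt2]; last by rewrite r0 ?mulr0 //; lia.
  have [lt2|le2] := ltnP (j - a k) 2; first by rewrite r0 // mulr0 rpred0.
  have -> : j.-2 = (a k + (j - a k).-2)%N by lia.
  by apply: dhomogM => //; exact: dhomog_linformX.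
have [x xP] := fin_all_exists dec.
pose r : {mpoly K[3]} := \sum_k linform (l k) ^+ a k * (x k).2 + G.
have [||c Ec [cp cq]] := @ideal_row_comb _ _ a j l0 l (fun k => (x k).1.1) (fun k => (x k).1.2) r.
- by apply: rpredD => //; apply: rpred_sum => k _; have [] := xP k.
- by move=> lt2; rewrite /r G0 // addr0 big1 // => k _; have [_ _] := xP k; exact.
have c0 : forall i, c i = 0.
  apply: (row_full_free full sq); rewrite Ec -[RHS]syz /r mulrDr addrA; congr (_ + _).
  rewrite mulr_sumr -big_split; apply: eq_bigr => k _ /=.
  by have [-> _ _] := xP k; rewrite [RHS]mulrDr; congr (_ + _); rewrite mulrCA.
move=> k; exists (x k).2; have [-> _ _] := xP k.
rewrite /binform !big1 ?mulr0 ?add0r // => b _.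
  by have := cq (Tagged (fun k => 'I_(j - a k)) b); rewrite c0 /= => <-; rewrite scale0r.
by have := cp (Tagged (fun k => 'I_(j.+1 - a k)) b); rewrite c0 /= => <-; rewrite scale0r.
Qed.

End FullRank.

Lemma eq_ideal_mx (A : comNzRingType) (J : finType) (a : J -> nat) j
    (l0 l0' : 'I_3 -> A) (l l' : J -> 'I_3 -> A) :
  l0 =1 l0' -> (forall k, l k =1 l' k) -> ideal_mx a j l0 l = ideal_mx a j l0' l'.
Proof.
move=> e0 e; have eg (c c' : 'I_3 -> A) : c =1 c' -> genform c = genform c'.
  by move=> ec; apply: eq_bigr => i _; rewrite ec.
apply/matrixP => i u; rewrite !mxE; congr (_@__).
by case: (enum_val i) => [[]|] v /=; rewrite ?(eg _ _ e0) ?(eg _ _ (e _)).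
Qed.

Lemma ideal_mx_open (K : fieldType) (J : finType) (a : J -> nat) j N
    (l0 : 'I_3 -> {mpoly K[N]}) (l : J -> 'I_3 -> {mpoly K[N]}) (w0 : 'I_N -> K) :
    row_full (ideal_mx a j (meval w0 \o l0) (fun k => meval w0 \o l k)) ->
  exists2 P : {mpoly K[N]}, P.@[w0] != 0 & forall w, P.@[w] != 0 ->
    row_full (ideal_mx a j (meval w \o l0) (fun k => meval w \o l k)).
Proof.
rewrite -map_ideal_mx => /row_full_open [P P0 PP]; exists P => // w /PP.
by rewrite map_ideal_mx.
Qed.

(** * Generic properties *)

(** The quantifiers are ordered as in the theorem: the open condition on L may depend on the chosen
    L_0, ..., L_s. *)
Definition generic {K : fieldType} {N : nat}
    (Phi : ('I_N -> K) -> ('I_3 -> K) -> Prop) : Prop :=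
  exists2 P : {mpoly K[N]}, P != 0 & forall v, P.@[v] != 0 ->
    exists2 Q : {mpoly K[3]}, Q != 0 & forall c, Q.@[c] != 0 -> Phi v c.

Section Generic.
Context {K : fieldType} {N : nat}.
Implicit Types Phi Psi : ('I_N -> K) -> ('I_3 -> K) -> Prop.

Lemma meval_neq0 n (P : {mpoly K[n]}) w : P.@[w] != 0 -> P != 0.
Proof. by apply: contra_neq => ->; rewrite meval0. Qed.

Lemma generic_imp Phi Psi :
  (forall v c, Phi v c -> Psi v c) -> generic Phi -> generic Psi.
Proof.
move=> sub [P nzP PP]; exists P => // v /PP [Q nzQ QQ]; exists Q => // c /QQ.
exact: sub.
Qed.

Lemma generic_and Phi Psi :
  generic Phi -> generic Psi -> generic (fun v c => Phi v c /\ Psi v c).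
Proof.
move=> [P nzP PP] [P' nzP' PP']; exists (P * P') => [|v]; first by rewrite mulf_neq0.
rewrite mevalM mulf_eq0 negb_or => /andP [/PP [Q nzQ QQ] /PP' [Q' nzQ' QQ']].
exists (Q * Q') => [|c]; first by rewrite mulf_neq0.
by rewrite mevalM mulf_eq0 negb_or => /andP [/QQ ? /QQ' ?].
Qed.

Lemma generic_forall_lt (Phi : nat -> ('I_N -> K) -> ('I_3 -> K) -> Prop) M :
  (forall n, (n < M)%N -> generic (Phi n)) ->
  generic (fun v c => forall n, (n < M)%N -> Phi n v c).
Proof.
elim: M => [|M IH] gPhi.
  by exists 1; rewrite ?oner_neq0 // => v _; exists 1; rewrite ?oner_neq0.
apply: generic_imp (generic_and (IH _) (gPhi M (ltnSn M))).
  by move=> v c [lt_PM PM] n; rewrite ltnS leq_eqVlt => /predU1P [->|/lt_PM].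
by move=> n lt_n; apply: gPhi; rewrite ltnS ltnW.
Qed.

End Generic.

(** * Generic full rank and maximal rank for the given ideal *)

Section Gens.
Context {K : fieldType} {s : nat}.
Implicit Types (a : 'I_s -> nat) (v : 'I_(s.+1 * 3) -> K).

Definition coefs v (k : 'I_s.+1) : 'I_3 -> K := fun i => v (mxvec_index k i).

Lemma gens_ord0 a v : gens a v ord0 = linform (coefs v ord0) ^+ 2.
Proof. by rewrite /gens /exps unlift_none. Qed.

Lemma gens_lift a v k : gens a v (lift ord0 k) = linform (coefs v (lift ord0 k)) ^+ a k.
Proof. by rewrite /gens /exps liftK. Qed.

Lemma dhomog_gens a v k : gens a v k \is (exps a k).-homog.
Proof. exact: dhomog_linformX. Qed.

(** [None] stands for the Lefschetz form and the right summand for fixed extra forms that pad the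
    matrix; L_0 enters separately, through its square. *)
Definition family p v (c : 'I_3 -> K) (pad : 'I_p -> 'I_3 -> K)
    (k : (option 'I_s + 'I_p)%type) : 'I_3 -> K :=
  match k with
  | inl None => c
  | inl (Some k) => coefs v (lift ord0 k)
  | inr m => pad m
  end.

(** Openness is used twice, starting from the witness: first in v, with c and the padding fixed,
    then in c for each v so obtained. *)
Lemma generic_row_full p (b : (option 'I_s + 'I_p)%type -> nat) j :
    [pchar K] =i pred0 -> (0 < j)%N ->
    (j < \sum_k (j - b k))%N || ((j - \sum_k (j - b k)).*2 < \sum_k (b k <= j))%N ->
  exists pad, generic (fun v c => coefs v ord0 i2 != 0 /\
    row_full (ideal_mx b j (coefs v ord0) (family v c pad))).
Proof.
move=> charK j_gt0 bnd; have [|t [u full]] := @witness_row_full K _ b j charK j_gt0.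
  have -> : (#|[set k | b k <= j]| = \sum_k (b k <= j))%N; last by [].
  by rewrite -sum1dep_card big_mkcond; apply: eq_bigr => k _; case: leqP.
pose pt k := point3 (t k) (u k); pose c0 := pt (inl None).
exists (fun m => pt (inr m)).
pose v0 : 'I_(s.+1 * 3) -> K := mxvec (\matrix_(k < s.+1, i < 3)
  (if unlift ord0 k is Some k' then pt (inl (Some k')) i else zcoef i)) 0.
have v00 : coefs v0 ord0 =1 zcoef.
  by move=> i; rewrite /coefs /v0 mxvecE mxE unlift_none.
have v0S k : coefs v0 (lift ord0 k) =1 pt (inl (Some k)).
  by move=> i; rewrite /coefs /v0 mxvecE mxE liftK.
have [|P P0 PP] := @ideal_mx_open K _ b j _ (fun i => 'X_(mxvec_index ord0 i))
  (fun k => match k with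
    | inl None => fun i => (c0 i)%:MP
    | inl (Some k) => fun i => 'X_(mxvec_index (lift ord0 k) i)
    | inr m => fun i => (pt (inr m) i)%:MP end) v0.
  rewrite (@eq_ideal_mx _ _ b j _ zcoef _ pt) // => [i|].
    by rewrite /= mevalXU; exact: v00.
  by move=> [[k|]|m] i /=; rewrite ?mevalC ?mevalXU -?v0S.
(* The extra factor keeps the z-coefficient of L_0 nonzero, as division by L_0 requires. *)
exists (P * 'X_(mxvec_index ord0 i2)) => [|v].
  apply: (@meval_neq0 _ _ _ v0); rewrite mevalM mevalXU mulf_neq0 //.
  by rewrite [v0 _]v00 oner_neq0.
rewrite mevalM mevalXU mulf_eq0 negb_or => /andP [/PP full_v nz_v].
have [|Q Q0 QQ] := @ideal_mx_open K _ b j 3 (fun i => (coefs v ord0 i)%:MP)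
  (fun k => match k with
    | inl None => fun i => 'X_i
    | inl (Some k) => fun i => (coefs v (lift ord0 k) i)%:MP
    | inr m => fun i => (pt (inr m) i)%:MP end) c0.
  congr (is_true (row_full _)): full_v; apply: eq_ideal_mx => [i|].
    by rewrite /= mevalC mevalXU.
  by move=> [[k|]|m] i /=; rewrite ?mevalC ?mevalXU.
exists Q => [|c /QQ full_c]; first exact: meval_neq0 Q0.
split=> //; congr (is_true (row_full _)): full_c; apply: eq_ideal_mx => [i|].
  by rewrite /= mevalC.
by move=> [[k|]|m] i /=; rewrite ?mevalC ?mevalXU.
Qed.

Lemma generic_max_rank a d i : [pchar K] =i pred0 -> (0 < d)%N ->
  generic (fun v c => mult_max_rank (gens a v) (linform c) d i).
Proof.
move=> charK d_gt0; set j := (i + d)%N; have j_gt0 : (0 < j)%N by lia.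
pose b0 (k : option 'I_s) := if k is Some k then a k else d.
pose e := (\sum_k (j - b0 k))%N; pose n := (\sum_k (b0 k <= j))%N.
(* An extra form of exponent j adds 1 to n and nothing to e, so p of them bring n up to 2(j - e) +
   1. When j < e or n is already that large, p is 0. *)
pose p := (if j < e then 0 else (j - e).*2.+1 - n)%N.
pose b (k : (option 'I_s + 'I_p)%type) := if k is inl k then b0 k else j.
have Eb : (\sum_k (j - b k) = e)%N.
  by rewrite big_sumType /= [X in (_ + X)%N]big1 ?addn0 // => m _; rewrite subnn.
have Enb : (\sum_k (b k <= j) = n + p)%N.
  rewrite big_sumType /=; congr (_ + _)%N.
  by under eq_bigr do rewrite leqnn; rewrite sum1_card card_ord.
have [|pad] := @generic_row_full p b j charK j_gt0.
  by rewrite Eb Enb /p; case: (ltnP j e) => //= _; lia.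
apply: generic_imp => v c [nz full]; case: (posnP p) => [p0|p_gt0].
  (* Without padding, L^d and the generators of I together generate all forms of degree j; the
     cofactor of L^d is the preimage. *)
  right=> h hh.
  pose g' (k : 'I_s.+2) := if unlift ord0 k is Some k' then gens a v k' else linform c ^+ d.
  pose b' (k : 'I_s.+2) := if unlift ord0 k is Some k' then exps a k' else d.
  have hg' k : g' k \is (b' k).-homog.
    by rewrite /g' /b'; case: unliftP => [k'|] _; [exact: dhomog_gens | exact: dhomog_linformX].
  have g'0 : g' ord0 = linform c ^+ d by rewrite /g' unlift_none.
  have g'S k : g' (lift ord0 k) = gens a v k by rewrite /g' liftK.
  have : in_ideal g' h.
    apply: (row_full_in_ideal full) hh => [|[[k|]|m] _ /=].
    - by rewrite -(gens_ord0 a) -g'S; exact: in_ideal_gen.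
    - by rewrite -gens_lift -g'S; exact: in_ideal_gen.
    - by rewrite -g'0; exact: in_ideal_gen.
    - by case: m => m lt_m; exfalso; rewrite -/p in p0; move: lt_m p0; clear; lia.
  case/(in_ideal_homog hg' hh) => q [Eh hq]; exists (q ord0).
    by have [+ _] := hq ord0; rewrite /b' unlift_none addnK.
  exists (fun k => q (lift ord0 k)); rewrite Eh big_ord_recl g'0 mulrC addrAC subrr add0r.
  by apply: eq_bigr => k _; rewrite g'S.
left=> f hf; have hLf : linform c ^+ d * f \is j.-homog.
  by rewrite /j addnC; apply: dhomogM => //; exact: dhomog_linformX.
case/(in_ideal_homog (dhomog_gens a v) hLf) => q [Ef hq].
(* With zero cofactors on the padding, the relation placing L^d f in I becomes a syzygy of the
   square system, so f is a multiple of L_0^2. *)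
pose H (k : (option 'I_s + 'I_p)%type) : {mpoly K[3]} := match k with
  | inl None => f | inl (Some k) => - q (lift ord0 k) | inr _ => 0 end.
have sq : #|row_index b j| = #|{: mon_index j.+1}|.
  rewrite card_row_index card_mon_index // Eb Enb; move: p_gt0; rewrite /p.
  by case: (ltnP j e) => // le_ej; lia.
have [||||r Er] := @row_full_syzygy _ _ b j _ _ full H (- q ord0) nz sq _ _ _ _ (inl None).
- move=> [[k|]|m] /=.
  + have [hqk q0] := hq (lift ord0 k); rewrite /exps liftK in hqk q0.
    by split=> [|/q0 ->]; rewrite ?oppr0 // rpredN.
  + by rewrite /j addnK; split=> //; lia.
  + by split=> //; exact: rpred0.
- by have [+ _] := hq ord0; rewrite /exps unlift_none rpredN subn2.
- by have [_ +] := hq ord0; rewrite /exps unlift_none => q0 /q0 ->; rewrite oppr0.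
- rewrite big_sumType /= [X in _ + X + _]big1 ?addr0 => [|m _]; last by rewrite mulr0.
  rewrite (bigD1 None) //= Ef big_ord_recl gens_ord0.
  rewrite [X in _ + X + _](_ : _ = - \sum_k q (lift ord0 k) * gens a v (lift ord0 k)).
    by rewrite addrK mulrN mulrC subrr.
  rewrite -sumrN (reindex_omap Some id) => [|[k|]] //=.
  by apply: eq_big => [k|k _]; rewrite ?eqxx // gens_lift mulrN mulrC.
rewrite /= in Er; rewrite Er -(gens_ord0 a) mulrC; exact/in_idealM/in_ideal_gen.
Qed.

(** For D = 1 + the sum of the a k, the D - a k add up to sD - (D - 1) >= D + 1 because s >= 2, so
    the generators of I already fill degree D. *)
Lemma generic_ideal_full_degree a : [pchar K] =i pred0 -> (2 <= s)%N ->
  generic (fun v _ => forall h, h \is (\sum_k a k).+1.-homog -> in_ideal (gens a v) h).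
Proof.
move=> charK s_ge2; set D := (\sum_k a k).+1.
(* No row is attached to an exponent larger than D, so this frees the
   statement from c. *)
pose b (k : (option 'I_s + 'I_0)%type) :=
  match k with inl (Some k) => a k | _ => D.+1 end.
have [||pad] := @generic_row_full 0 b D charK => //.
  apply/orP; left; rewrite big_sumType /= [X in (_ + X)%N]big_ord0 addn0.
  rewrite (bigD1 None) //= (reindex_omap Some id) => [|[k|]] //=.
  under eq_bigl do rewrite eqxx.
  have : (\sum_(k < s) (D - a k) + \sum_k a k = s * D)%N.
    rewrite -big_split /= -[in RHS](card_ord s) -sum_nat_const.
    apply: eq_bigr => k _; rewrite subnK // /D (bigD1 k) //=; lia.
  move=> E; rewrite -(ltn_add2r (\sum_k a k)) -addnA E.
  apply: leq_trans (leq_addl _ _); apply: leq_trans (leq_mul s_ge2 (leqnn D)).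
  by rewrite mul2n -addnn ltn_add2l.
apply: generic_imp => v c [_ full]; apply: (row_full_in_ideal full).
  by rewrite -(gens_ord0 a); exact: in_ideal_gen.
move=> [[k|]|[]] //=; last by rewrite ltnn.
by rewrite -gens_lift => _; exact: in_ideal_gen.
Qed.

End Gens.

Theorem theorem7p1 (K : fieldType) (charK0 : [pchar K] =i pred0)
  (s : nat) (hs : (2 <= s)%N) (a : 'I_s -> nat) (ha : forall k, (0 < a k)%N) :
  exists2 P : {mpoly K[s.+1 * 3]}, P != 0 &
    forall v : 'I_(s.+1 * 3) -> K, P.@[v] != 0 ->
      exists2 Q : {mpoly K[3]}, Q != 0 &
        forall c : 'I_3 -> K, Q.@[c] != 0 ->
          SLP_wrt (gens a v) (linform c).
Proof.
pose D := (\sum_k a k).+1.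
change (generic (fun (v : 'I_(s.+1 * 3) -> K) c => SLP_wrt (gens a v) (linform c))).
(* From degree D on R/I is zero, so open conditions are imposed only for the finitely many pairs d,
   i < D, and their intersection is again open and nonempty. *)
have small : generic (fun (v : 'I_(s.+1 * 3) -> K) c =>
    forall d, (d < D)%N -> forall i, (i < D)%N ->
      (0 < d)%N -> mult_max_rank (gens a v) (linform c) d i).
  apply: generic_forall_lt => d _; apply: generic_forall_lt => i _.
  case: (posnP d) => [->|d_gt0].
    by exists 1; rewrite ?oner_neq0 // => v _; exists 1; rewrite ?oner_neq0.
  by apply: generic_imp (generic_max_rank a i charK0 d_gt0).
apply: generic_imp (generic_and (generic_ideal_full_degree a charK0 hs) small).
move=> v c [big {}small] d i d_gt0; have [lt_D|le_D] := ltnP (i + d) D.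
  by apply: small => //; lia.
(* The target is zero here, so the map is surjective. *)
right=> h hh; exists 0; first exact: rpred0.
by rewrite mulr0 subr0; exact: in_ideal_gt_degree big le_D _ hh.
Qed.
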